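(* There exists a break-free $\mathbb{N}$-barrycade of infinite height, that is, there exists an infinite sequence $(\mu_1,\mu_2,\mu_3,\ldots)$ of permutations of $\mathbb{N}$ such that $S_{\mu_i}\cap S_{\mu_j}=\emptyset$ for all $i\neq j$ and $\bigcup_{i\geq 1}S_{\mu_i}=\mathbb{N}$.
   Context: $\mathbb{N}$ denotes the set of positive integers. A permutation of $\mathbb{N}$ is an infinite sequence $\mu=(a_1,a_2,a_3,\ldots)$ of positive integers in which every positive integer appears exactly once (i.e. $i\mapsto a_i$ is a bijection $\mathbb{N}\to\mathbb{N}$). Its set of partial sums is $S_\mu=\{a_1,\ a_1+a_2,\ a_1+a_2+a_3,\ \ldots\}$. An $\mathbb{N}$-barrycade (of infinite height) is an infinite collection $(\mu_1,\mu_2,\mu_3,\ldots)$ of permutations of $\mathbb{N}$ such that $S_{\mu_i}\cap S_{\mu_j}=\emptyset$ for all $i\neq j$. It is break-free if every positive integer is a partial sum of one of its rows, i.e. $\bigcup_{i\geq 1}S_{\mu_i}=\mathbb{N}$. *)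

(* Defs.v *)
From mathcomp Require Import all_boot.
From mathcomp Require Import classical_sets functions.

Set Implicit Arguments.
Unset Strict Implicit.
Unset Printing Implicit Defensive.

Local Open Scope classical_set_scope.

Definition posnat : set nat := [set n | 0 < n].

(* A sequence (a_1, a_2, ...) is a function a : nat -> nat of which only the
   values at positive indices matter: the value a 0 is unconstrained and occurs
   in none of the notions below.  Likewise for the sequence of rows. *)

Definition is_permutation (a : nat -> nat) : Prop := set_bij posnat posnat a.

Definition partial_sums (a : nat -> nat) : set nat :=
  [set \sum_(1 <= j < n.+1) a j | n in posnat].

Definition barrycade (mu : nat -> nat -> nat) : Prop :=
  (forall i, posnat i -> is_permutation (mu i)) /\
  (forall i j, posnat i -> posnat j -> i <> j ->
     partial_sums (mu i) `&` partial_sums (mu j) = set0).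

Definition break_free (mu : nat -> nat -> nat) : Prop :=
  \bigcup_(i in posnat) partial_sums (mu i) = posnat.

(* Main.v *)
(* A row can always be prolonged so as to contain a prescribed missing brick k:
   first put a brick so large that both its end and the end of a brick k laid
   after it lie beyond every position used so far.  A position n that is still
   uncovered is covered by opening a new row with the single brick n.  Doing
   both in turn, and visiting every row infinitely often, every stage being
   finite, yields the rows of the barrycade in the limit. *)
Require Import Defs.
From mathcomp Require Import all_boot.
From mathcomp Require Import classical_sets functions.
From mathcomp Require Import zify.

Set Implicit Arguments.
Unset Strict Implicit.
Unset Printing Implicit Defensive.

(** * Least number missing from a list *)

Lemma leq_sumn (s : seq nat) (x : nat) : x \in s -> x <= sumn s.
Proof.
elim: s => //= y s IHs; rewrite inE => /orP[/eqP->|/IHs]; first exact: leq_addr.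
by move/leq_trans; apply; apply: leq_addl.
Qed.

Lemma exists_notin (s : seq nat) : exists n, n \notin s.
Proof. by exists (sumn s).+1; apply/negP => /leq_sumn; rewrite ltnn. Qed.

Definition mex (s : seq nat) : nat := ex_minn (exists_notin s).

Lemma mex_notin (s : seq nat) : mex s \notin s.
Proof. by rewrite /mex; case: ex_minnP. Qed.

Lemma lt_mex (s : seq nat) (n : nat) : n < mex s -> n \in s.
Proof.
rewrite /mex; case: ex_minnP => m _ min_m lt_nm.
by apply: contraLR lt_nm; rewrite -leqNgt; apply: min_m.
Qed.

Lemma mex_cons0_gt0 (s : seq nat) : 0 < mex (0 :: s).
Proof. by case: (mex _) (mex_notin (0 :: s)) => //; rewrite inE eqxx. Qed.

(** The mex is at least [m]: either it equals [m], or [m] already lies in [s]. This measures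
    progress both for covered positions and for the bricks of a row. *)
Lemma mem_iota_mex (s : seq nat) (m : nat) :
  {subset iota 0 m <= s} -> {subset iota 0 m.+1 <= mex s :: s}.
Proof.
move=> sub_ms x; rewrite mem_iota leq0n add0n ltnS inE /= => le_xm.
case: (ltngtP x (mex s)) => [/lt_mex // | lt_mex_x | //] /=.
by case/negP: (mex_notin s); apply: sub_ms; rewrite mem_iota; lia.
Qed.

(** * Finite stages and their invariant *)

Definition psum (r : seq nat) (x : nat) : Prop :=
  exists2 n, 0 < n <= size r & x = sumn (take n r).

Lemma psum_rcons (r : seq nat) (b x : nat) :
  psum (rcons r b) x <-> psum r x \/ x = sumn r + b.
Proof.
split=> [[n] | [[n le_n ->] | ->]].
- rewrite size_rcons => /andP[n_gt0]; rewrite leq_eqVlt ltnS => /predU1P[->|le_n] ->.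
    by right; rewrite -(size_rcons r b) take_size sumn_rcons.
  by left; exists n; rewrite ?n_gt0 // -cats1 takel_cat.
- by exists n; [rewrite size_rcons; lia | rewrite -cats1 takel_cat //; lia].
- by exists (size r).+1; rewrite ?size_rcons ?leqnn // -(size_rcons r b) take_size sumn_rcons.
Qed.

(* The rows built so far, and the list of the positions already used, among
   which 0 is counted. *)
Definition state : Type := ((nat -> seq nat) * seq nat)%type.

Definition append (i b : nat) (s : state) : state :=
  (fun j => if j == i then rcons (s.1 i) b else s.1 j, sumn (s.1 i) + b :: s.2).

(** The leading [0] makes [uniq] force positive bricks as well. Disjointness is possible because
    [psum] omits the empty prefix, whose sum all rows share. *)
Record legal (s : state) : Prop := Legal {
  legal_uniq : forall i, uniq (0 :: s.1 i);
  legal_disj : forall i j x, psum (s.1 i) x -> psum (s.1 j) x -> i = j;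
  legal_used : forall x, x \in s.2 <-> x = 0 \/ exists i, psum (s.1 i) x }.

Lemma legal_append (i b : nat) (s : state) :
  b \notin 0 :: s.1 i -> sumn (s.1 i) + b \notin s.2 -> legal s ->
  legal (append i b s).
Proof.
move=> new_b new_pos [Us Ds Cs].
(* The only new partial sum is the end of the new brick, and no row has it yet. *)
have new j x : x = sumn (s.1 i) + b -> ~ psum (s.1 j) x.
  by move=> -> Hx; case/negP: new_pos; apply/Cs; right; exists j.
split=> /=.
- move=> j; case: eqP => [_|_]; last exact: Us.
  suff: uniq (rcons (0 :: s.1 i) b) by [].
  by rewrite rcons_uniq new_b Us.
- move=> j k x; case: eqP => [->|_]; case: eqP => [->|_] //.
  + by move/psum_rcons => [|/new Hn]; [apply: Ds | move/Hn].
  + by move=> Hj /psum_rcons[|/new Hn]; [apply: Ds | case: (Hn _ Hj)].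
  + exact: Ds.
- move=> x; rewrite inE; split=> [/predU1P[->|/Cs[->|[j Hj]]]|].
  + by right; exists i; rewrite eqxx; apply/psum_rcons; right.
  + by left.
  + right; exists j; case: eqP => [eji|//]; apply/psum_rcons; left.
    by rewrite -eji.
  + case=> [->|[j]]; first by apply/orP; right; apply/Cs; left.
    case: eqP => [_ /psum_rcons[Hx|->]|_ Hx]; rewrite ?eqxx //;
      by apply/orP; right; apply/Cs; right; eexists; exact: Hx.
Qed.

Definition cover (t : nat) (s : state) : state := append t (mex s.2) s.

(** The three summands bound, in turn, the used positions, the bricks of row [i], and the missing
    brick to be laid next. *)
Definition filler (i : nat) (s : state) : nat :=
  (sumn s.2 + sumn (s.1 i) + mex (0 :: s.1 i)).+1.

Definition fill (i : nat) (s : state) : state :=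
  append i (mex (0 :: s.1 i)) (append i (filler i s) s).

Lemma legal_cover (t : nat) (s : state) :
  s.1 t = [::] -> legal s -> legal (cover t s).
Proof.
move=> st0 Ls; apply: legal_append => //; rewrite st0 ?mex_notin //.
rewrite inE; apply: contra (mex_notin s.2) => /eqP ->.
by apply/(legal_used Ls); left.
Qed.

Lemma legal_fill (i : nat) (s : state) : legal s -> legal (fill i s).
Proof.
move=> Ls; have k_gt0 := mex_cons0_gt0 (s.1 i).
apply: legal_append => /=; rewrite ?eqxx.
- rewrite -rcons_cons mem_rcons inE negb_or mex_notin andbT /filler; lia.
(* The missing brick is positive, so its end differs from that of the filler. *)
- rewrite sumn_rcons inE negb_or; apply/andP; split; first lia.
  by apply/negP => /leq_sumn; rewrite /filler; lia.
apply: legal_append => //.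
- by rewrite inE negb_or /=; apply/negP => /leq_sumn; rewrite /filler; lia.
- by apply/negP => /leq_sumn; rewrite /filler; lia.
Qed.

(* [logn 2 t.+1] takes each value infinitely often and is at most [t], so the
   row filled at stage [t] is already open. *)
Fixpoint stage (t : nat) : state :=
  if t is t'.+1 then fill (logn 2 t'.+1) (cover t' (stage t'))
  else (fun=> [::], [:: 0]).

Lemma stage_row_nil (t i : nat) : t <= i -> (stage t).1 i = [::].
Proof.
elim: t => //= t IHt lt_ti; have ltn_v := ltn_logl 2 (ltn0Sn t).
by rewrite !ifN_eq ?IHt //; lia.
Qed.

Lemma legal_stage (t : nat) : legal (stage t).
Proof.
elim: t => [|t IHt]; last first.
  by apply/legal_fill/legal_cover => //; apply: stage_row_nil.
split=> //= [i j x [n]|x]; first by rewrite leqn0; lia.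
rewrite inE; split=> [/eqP|[->|[_ [n]]]] //; [by left | rewrite leqn0; lia].
Qed.

(** * Growth of the rows, and visits to a given row *)

Lemma prefix_append (i b j : nat) (s : state) : prefix (s.1 j) ((append i b s).1 j).
Proof. by rewrite /=; case: eqP => [->|_]; rewrite ?prefix_rcons ?prefix_refl. Qed.

Lemma prefix_stage (i t u : nat) :
  t <= u -> prefix ((stage t).1 i) ((stage u).1 i).
Proof.
elim: u => [|u IHu]; first by rewrite leqn0 => /eqP->; apply: prefix_refl.
rewrite leq_eqVlt ltnS => /predU1P[->|/IHu le_tu]; first exact: prefix_refl.
(* One stage consists of three appends: the covering brick, the filler and the missing brick. *)
do 3 apply: (prefix_trans _ (prefix_append _ _ _ _)).
exact: le_tu.
Qed.

Lemma sub_stage (i t u : nat) :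
  t <= u -> {subset (stage t).1 i <= (stage u).1 i}.
Proof. by move/(prefix_stage i)/prefixP => [r ->] x; rewrite mem_cat => ->. Qed.

Lemma stage_used (t : nat) : {subset iota 0 t.+1 <= (stage t).2}.
Proof.
elim: t => [|t IHt x Hx]; first by [].
have := mem_iota_mex IHt Hx.
by rewrite /= !inE stage_row_nil //= => ->; rewrite !orbT.
Qed.

(** These are exactly the numbers of 2-adic valuation [i], in increasing order: the stages whose
    last step fills row [i]. *)
Definition visit (i j : nat) : nat := 2 ^ i * j.*2.+1.

Lemma visit_gt0 (i j : nat) : 0 < visit i j.
Proof. by rewrite muln_gt0 expn_gt0. Qed.

Lemma logn_visit (i j : nat) : logn 2 (visit i j) = i.
Proof.
rewrite lognM ?expn_gt0 // pfactorK // lognE /= dvdn2 /= odd_double.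
by rewrite addn0.
Qed.

Lemma ltn_visit (i j : nat) : visit i j < visit i j.+1.
Proof. by rewrite ltn_pmul2l ?expn_gt0 // doubleS; lia. Qed.

Lemma visit_mex (i j : nat) (s := cover (visit i j).-1 (stage (visit i j).-1)) :
  (stage (visit i j)).1 i = rcons (rcons (s.1 i) (filler i s)) (mex (0 :: s.1 i)).
Proof.
rewrite {}/s; move: (visit_gt0 i j) (logn_visit i j); case: (visit i j) => // t _.
by move=> /= ->; rewrite /= !eqxx.
Qed.

(** Each of the visits [0] to [j] supplies the least missing brick, and row [i] only grows in
    between. *)
Lemma visit_sub (i j : nat) :
  {subset iota 0 j.+2 <= 0 :: (stage (visit i j)).1 i}.
Proof.
have step (k : nat) (s := cover (visit i k).-1 (stage (visit i k).-1)) :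
    {subset iota 0 k.+1 <= 0 :: s.1 i} ->
    {subset iota 0 k.+2 <= 0 :: (stage (visit i k)).1 i}.
  move=> /mem_iota_mex sub_s x /sub_s; rewrite visit_mex -/s !(inE, mem_rcons).
  by case/or3P => ->; rewrite ?orbT.
elim: j => [|j IHj]; apply: step => x.
  by rewrite mem_iota !inE; lia.
move/IHj; rewrite !inE => /orP[->//|Hx]; apply/orP; right.
have le_v : visit i j <= (visit i j.+1).-1 by have := ltn_visit i j; lia.
have /prefixP[r ->] := prefix_append (visit i j.+1).-1
  (mex (stage (visit i j.+1).-1).2) i (stage (visit i j.+1).-1).
by rewrite mem_cat (sub_stage le_v).
Qed.

(** Pigeonhole on [visit_sub]. Hence entry [j] of row [i] is in place at stage [visit i j], and the
    default of [nth] in [row] is never reached. *)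
Lemma visit_size (i j : nat) : j < size ((stage (visit i j)).1 i).
Proof.
have := uniq_leq_size (iota_uniq 0 j.+2) (@visit_sub i j).
by rewrite size_iota.
Qed.

(** * The limit rows *)

Definition row (i j : nat) : nat := nth 0 ((stage (visit i j)).1 i) j.

Lemma nth_prefix (s r : seq nat) (j : nat) :
  prefix s r -> j < size s -> nth 0 r j = nth 0 s j.
Proof. by move=> /prefixP[u ->] lt_j; rewrite nth_cat lt_j. Qed.

(** Of two stages of a row one is a prefix of the other, so an entry never changes once laid. *)
Lemma rowE (i j t : nat) : j < size ((stage t).1 i) -> row i j = nth 0 ((stage t).1 i) j.
Proof.
move=> lt_j; have lt_v := visit_size i j; rewrite /row.
case: (leqP t (visit i j)) => [|/ltnW] /(prefix_stage i) p.
  exact: nth_prefix.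
by rewrite (nth_prefix p).
Qed.

Lemma size_stage (i t u : nat) : t <= u -> size ((stage t).1 i) <= size ((stage u).1 i).
Proof. by move/(prefix_stage i)/prefixP => [r ->]; rewrite size_cat leq_addr. Qed.

Lemma row_gt0 (i j : nat) : 0 < row i j.
Proof.
have /andP[/negP r0 _] := legal_uniq (legal_stage (visit i j)) i.
by rewrite lt0n; apply/negP => /eqP ri; apply: r0; rewrite -ri mem_nth ?visit_size.
Qed.

Lemma row_inj (i : nat) : injective (row i).
Proof.
move=> j k; set t := maxn (visit i j) (visit i k).
have lt_j : j < size ((stage t).1 i).
  exact: leq_trans (visit_size i j) (size_stage i (leq_maxl _ _)).
have lt_k : k < size ((stage t).1 i).
  exact: leq_trans (visit_size i k) (size_stage i (leq_maxr _ _)).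
rewrite (rowE lt_j) (rowE lt_k) => /eqP.
by case/andP: (legal_uniq (legal_stage t) i) => _ Ut; rewrite nth_uniq // => /eqP.
Qed.

Lemma row_surj (i x : nat) : 0 < x -> exists j, row i j = x.
Proof.
move=> x_gt0; have : x \in 0 :: (stage (visit i x)).1 i.
  by apply: visit_sub; rewrite mem_iota; lia.
rewrite inE => /predU1P[x0|]; first by rewrite x0 in x_gt0.
by case/(nthP 0) => j lt_j <-; exists j; rewrite (rowE lt_j).
Qed.

Lemma sum_row (i n t : nat) : n <= size ((stage t).1 i) ->
  \sum_(0 <= j < n) row i j = sumn (take n ((stage t).1 i)).
Proof.
move=> le_n; rewrite sumnE [RHS](big_nth 0) size_takel // !big_mkord.
apply: eq_bigr => j _; rewrite nth_take //; apply: rowE.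
exact: leq_trans (ltn_ord j) le_n.
Qed.

Lemma psum_row (i n t : nat) : 0 < n <= size ((stage t).1 i) ->
  psum ((stage t).1 i) (\sum_(0 <= j < n) row i j).
Proof. by move=> le_n; exists n => //; apply: sum_row; case/andP: le_n. Qed.

Lemma row_disj (i k m n : nat) : 0 < m -> 0 < n ->
  \sum_(0 <= j < m) row i j = \sum_(0 <= j < n) row k j -> i = k.
Proof.
(* At the later of the two visits both sums are partial sums of one legal state. *)
move=> m_gt0 n_gt0 eq_sum; set t := maxn (visit i m) (visit k n).
have le_m : 0 < m <= size ((stage t).1 i).
  by rewrite m_gt0 ltnW // (leq_trans (visit_size i m)) ?size_stage ?leq_maxl.
have le_n : 0 < n <= size ((stage t).1 k).
  by rewrite n_gt0 ltnW // (leq_trans (visit_size k n)) ?size_stage ?leq_maxr.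
apply: (legal_disj (legal_stage t) (psum_row le_m)).
by rewrite eq_sum; apply: psum_row.
Qed.

Lemma row_cover (x : nat) : 0 < x ->
  exists i, exists2 n, 0 < n & \sum_(0 <= j < n) row i j = x.
Proof.
move=> x_gt0; have : x \in (stage x).2 by apply: stage_used; rewrite mem_iota /=.
case/(legal_used (legal_stage x)) => [x0|[i [n /andP[n_gt0 le_n] ->]]].
  by rewrite x0 in x_gt0.
by exists i, n => //; apply: sum_row.
Qed.

Theorem theorem4 : exists mu : nat -> nat -> nat, barrycade mu /\ break_free mu.
Proof.
(* The construction counts rows and bricks from 0, the statement from 1. *)
exists (fun i j => row i.-1 j.-1).
have sumE i n : \sum_(1 <= j < n.+1) row i j.-1 = \sum_(0 <= j < n) row i j.
  by rewrite big_add1.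
split; first split.
- move=> i _; split=> [j _|j k|x /row_surj-/(_ i.-1)[j <-]].
  + exact: row_gt0.
  + rewrite !inE /posnat /= => j_gt0 k_gt0 /row_inj; lia.
  + by exists j.+1.
- move=> i j i_gt0 j_gt0 neq_ij; apply/seteqP; split=> // x [[m m_gt0 <-] [n n_gt0]].
  rewrite !sumE => /esym/row_disj eq_ij; case: neq_ij.
  by move: i_gt0 j_gt0 (eq_ij m_gt0 n_gt0); rewrite /posnat /=; lia.
- apply/seteqP; split=> [x [i _ [n n_gt0 <-]]|x /row_cover[i [n n_gt0 <-]]].
  + by rewrite sumE; case: n n_gt0 => // n _; rewrite /posnat /= big_nat_recr //= addn_gt0 row_gt0 orbT.
  + by exists i.+1 => //; exists n => //; rewrite sumE.
Qed.
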